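(* Consider the symmetric group $\mathfrak{S}_n$ as a poset under the Bruhat order, and let $\sigma_k\le w$. The interval $[\sigma_k,w]$ is boolean (equivalently, a modular lattice, or a distributive lattice) if and only if there is a reduced decomposition $x\,\sigma_k\,y\in R(w)$ such that (1) $x$ and $y$ are each (possibly empty) products of distinct generators; (2) the only generators that may appear in both $x$ and $y$ are $\sigma_{k-1}$ and $\sigma_{k+1}$; and (3) $\sigma_k$ does not appear in $x$ or in $y$.
   Context: $\mathfrak{S}_n$ is the symmetric group with Coxeter generators $\sigma_1,\dots,\sigma_{n-1}$, where $\sigma_i$ is the transposition swapping $i$ and $i+1$; here $1\le k\le n-1$. A reduced decomposition of $w$ is a word $s_1\cdots s_\ell$ in these generators with product $w$ and $\ell$ minimal; $R(w)$ is the set of reduced decompositions of $w$. Bruhat order: $v\le w$ if some reduced decomposition of $v$ is a (not necessarily contiguous) subword of a reduced decomposition of $w$. $[v,w]=\{u: v\le u\le w\}$. A poset is boolean if it is isomorphic to the poset of all subsets of a finite set, ordered by inclusion. In the claim $x$ and $y$ are words in the generators. *)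

(* Defs.v *)
From mathcomp Require Import all_boot all_order all_fingroup.

Set Implicit Arguments.
Unset Strict Implicit.
Unset Printing Implicit Defensive.

Import Order.Theory.

(* Generators are indexed from 0: the letter [i : 'I_n.-1] stands for the
   simple transposition of the elements [i] and [i.+1] of ['I_n], which is
   sigma_(i+1) when 'S_n acts on {1, ..., n}. *)
Lemma letter_succ_lt (n : nat) (i : 'I_n.-1) : i.+1 < n.
Proof. by rewrite -ltn_predRL. Qed.

Definition sigma (n : nat) (i : 'I_n.-1) : 'S_n :=
  tperm (Ordinal (ltnW (letter_succ_lt i))) (Ordinal (letter_succ_lt i)).

Definition word_prod (n : nat) (s : seq 'I_n.-1) : 'S_n :=
  (\prod_(i <- s) sigma i)%g.

Definition reduced_decomposition (n : nat) (w : 'S_n) (s : seq 'I_n.-1) : Prop :=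
  word_prod s = w /\
  forall t : seq 'I_n.-1, word_prod t = w -> size s <= size t.

Definition bruhat (n : nat) (v w : 'S_n) : Prop :=
  exists s t : seq 'I_n.-1,
    [/\ reduced_decomposition v s, reduced_decomposition w t & subseq s t].

Definition bruhat_interval (n : nat) (v w u : 'S_n) : Prop :=
  bruhat v u /\ bruhat u w.

(* The subset [D] of [T], ordered by [leT], is isomorphic to [U] ordered by
   [leU]. Only the values of [f] on [D] matter; [exists!] makes [f] a bijection
   from [D] onto [U]. *)
Definition order_isomorphic (T : Type) (D : T -> Prop) (leT : T -> T -> Prop)
    (U : Type) (leU : U -> U -> Prop) : Prop :=
  exists f : T -> U,
    (forall a : U, exists! u : T, D u /\ f u = a) /\
    (forall u v : T, D u -> D v -> (leT u v <-> leU (f u) (f v))).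

Definition is_boolean (T : Type) (D : T -> Prop) (leT : T -> T -> Prop) : Prop :=
  exists X : finType,
    order_isomorphic D leT (fun A B : {set X} => A \subset B).

Definition is_modular_lattice
    (T : Type) (D : T -> Prop) (leT : T -> T -> Prop) : Prop :=
  exists (d : Order.disp_t) (L : latticeType d),
    (forall a b c : L, (a <= b)%O -> (a `|` (c `&` b) = (a `|` c) `&` b)%O) /\
    order_isomorphic D leT (fun a b : L => (a <= b)%O).

Definition is_distributive_lattice
    (T : Type) (D : T -> Prop) (leT : T -> T -> Prop) : Prop :=
  exists (d : Order.disp_t) (L : distrLatticeType d),
    order_isomorphic D leT (fun a b : L => (a <= b)%O).

(* Main.v *)
(* Write k for sigma_k, and call length-two elements above k atoms; they are the products ak and ka.

   Every subword x' k y' of a word x k y satisfying (1)-(3) is reduced, and the atoms below it tell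
   which letters x' and y' contain. Hence mapping an element to the set of atoms below it is an
   isomorphism of [k, w] onto a power set.

   Conversely, let [k, w] be modular. Bruhat intervals of length two have two middle elements, so
   every u in [k, w] is the join of the atoms below it; joining with an atom raises the length by at
   most one, so the length of u is at most one plus the number of atoms below u. Moreover k a b k is
   not below w when {a, b} = {k-1, k+1}, as [k, kabk] is a 4-crown. By induction on length, w has a
   reduced word x k y with a single letter k: delete a first or last letter other than k; otherwise
   every reduced word has the form k y k, where y uses distinct letters and starts and ends with
   neighbours of k, so that y is one letter (braid relation) or contains a crown. In such a word
   every letter of x and y gives at most one atom, and the atom count forces (1)-(3). *)
Require Import Defs.
From mathcomp Require Import all_boot all_order all_fingroup.
From mathcomp Require Import zify.

Set Implicit Arguments.
Unset Strict Implicit.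
Unset Printing Implicit Defensive.

Import Order.Theory GroupScope.

(** * Words, length and the exchange property in the symmetric group *)

Section Bruhat.

Variable n : nat.
Implicit Types (a b k : 'I_n.-1) (u v w : 'S_n) (s t x y : seq 'I_n.-1).

Local Notation wp := (@word_prod n).

Definition lo a : 'I_n := Ordinal (ltnW (letter_succ_lt a)).
Definition hi a : 'I_n := Ordinal (letter_succ_lt a).

Lemma sigmaE a : sigma a = tperm (lo a) (hi a).
Proof. by []. Qed.

Lemma lo_neq_hi a : lo a != hi a.
Proof. by rewrite -val_eqE /= ltn_eqF. Qed.

Lemma sigma_lo a : sigma a (lo a) = hi a.
Proof. by rewrite sigmaE tpermL. Qed.

Lemma sigma_hi a : sigma a (hi a) = lo a.
Proof. by rewrite sigmaE tpermR. Qed.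

Lemma sigmaK a u : sigma a * (sigma a * u) = u.
Proof. by rewrite mulgA sigmaE tperm2 mul1g. Qed.

Lemma sigma2 a : sigma a * sigma a = 1.
Proof. by rewrite sigmaE tperm2. Qed.

Lemma sigma_fix a (p : 'I_n) : p != a :> nat -> p != a.+1 :> nat -> sigma a p = p.
Proof.
by move=> h1 h2; rewrite sigmaE tpermD // -val_eqE /= eq_sym.
Qed.

Lemma wp_cons a s : wp (a :: s) = sigma a * wp s.
Proof. by rewrite /word_prod big_cons. Qed.

Lemma wp_nil : wp [::] = 1.
Proof. by rewrite /word_prod big_nil. Qed.

Lemma wp_cat s t : wp (s ++ t) = wp s * wp t.
Proof. by rewrite /word_prod big_cat. Qed.

Lemma wp1 a : wp [:: a] = sigma a.
Proof. by rewrite wp_cons wp_nil mulg1. Qed.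

(** Conjugation by the letter at [i + m] turns the transposition of [i] and [i + m] into that of [i]
    and [i + m.+1]. For [m = 0] this letter also moves [i], but is then itself the transposition
    sought. *)
Lemma tperm_word (m : nat) (i j : 'I_n) : j = i + m :> nat -> exists s, wp s = tperm i j.
Proof.
elim: m j => [|m IHm] j ij.
  exists [::]; rewrite wp_nil; have -> : j = i by apply: val_inj; rewrite /= ij addn0.
  by rewrite tperm1.
have ltm : i + m < n.-1 by have := ltn_ord j; lia.
pose a := Ordinal ltm.
have [s sE] := IHm (lo a) erefl.
have hiE : hi a = j by apply: val_inj; rewrite /= ij addnS.
case: (posnP m) => [m0|m_gt0].
  exists [:: a]; rewrite wp1 sigmaE hiE; congr tperm; apply: val_inj; rewrite /=; lia.
exists (a :: rcons s a).
rewrite wp_cons -cats1 wp_cat wp1 sE.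
rewrite -{1}[sigma a]invgK {1}sigmaE tpermV -sigmaE -conjgE tpermJ sigma_lo.
rewrite sigma_fix ?hiE //=; lia.
Qed.

Lemma word_exists u : exists s, wp s = u.
Proof.
have [ts -> _] := prod_tpermP u.
elim: ts => [|[i j] ts [s sE]]; first by exists [::]; rewrite wp_nil big_nil.
have [t tE] : exists t, wp t = tperm i j.
  case: (leqP i j) => ij; first by apply: (@tperm_word (j - i)); lia.
  by rewrite tpermC; apply: (@tperm_word (i - j)); lia.
by exists (t ++ s); rewrite wp_cat big_cons sE tE.
Qed.

Lemma len_subproof u : exists m, [exists s : m.-tuple 'I_n.-1, wp s == u].
Proof.
by have [s sE] := word_exists u; exists (size s); apply/existsP; exists (in_tuple s); apply/eqP.
Qed.

(** The length is the least size of a word, to match [reduced_decomposition]; its link with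
    inversions comes from [strong_exchange]. *)
Definition len u := ex_minn (len_subproof u).

Lemma len_le s : len (wp s) <= size s.
Proof.
rewrite /len; case: ex_minnP => m _; apply.
by apply/existsP; exists (in_tuple s); apply/eqP.
Qed.

Lemma len_word u : exists2 s, wp s = u & size s = len u.
Proof.
rewrite /len; case: ex_minnP => m /existsP[s /eqP sE] _.
by exists s => //; rewrite size_tuple.
Qed.

Definition reduced s := size s == len (wp s).

Lemma reduced_decompositionE w s : reduced_decomposition w s <-> wp s = w /\ reduced s.
Proof.
split=> [[sE smin]|[<- /eqP red_s]]; split=> //.
  have [t tE tlen] := len_word w.
  by rewrite /reduced eqn_leq len_le andbT sE -tlen smin.
by move=> t tE; rewrite red_s -tE len_le.
Qed.

Lemma reduced_word u : exists2 s, wp s = u & reduced s.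
Proof. by have [s sE slen] := len_word u; exists s; rewrite // /reduced sE slen. Qed.

Lemma len_mul u v : len (u * v) <= len u + len v.
Proof.
have [s <- <-] := len_word u; have [t <- <-] := len_word v.
by rewrite -wp_cat -size_cat len_le.
Qed.

Lemma reduced_cat s t : reduced (s ++ t) -> reduced s /\ reduced t.
Proof.
rewrite /reduced wp_cat size_cat => /eqP st.
have := len_mul (wp s) (wp t); have := len_le s; have := len_le t.
by rewrite -st => ? ? ?; split; apply/eqP; lia.
Qed.

Lemma reduced_behead a s : reduced (a :: s) -> reduced s.
Proof. by rewrite -cat1s => /reduced_cat[]. Qed.

(* Products act from left to right, so multiplying by [sigma a] on the left exchanges the values at
   [lo a] and [hi a]: [ascent u a] means that [sigma a * u] is longer than [u]. *)
Definition ascent u a := u (lo a) < u (hi a).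

Lemma perm_ltnNge u (i j : 'I_n) : i != j -> (u i < u j) = ~~ (u j < u i).
Proof.
move=> ij; have : u i != u j by rewrite (inj_eq perm_inj).
by rewrite -val_eqE /=; lia.
Qed.

Lemma ascentN u a : ~~ ascent u a = (u (hi a) < u (lo a)).
Proof. by rewrite /ascent [X in _ = X]perm_ltnNge // eq_sym lo_neq_hi. Qed.

Lemma ascent_sigma u a : ascent (sigma a * u) a = ~~ ascent u a.
Proof. by rewrite ascentN /ascent !permM sigma_lo sigma_hi. Qed.

Lemma sigma_lt a (i j : 'I_n) : i < j -> (i == lo a) && (j == hi a) = false ->
  sigma a i < sigma a j.
Proof.
move=> ij; rewrite -!val_eqE /= => h; rewrite sigmaE.
by case: tpermP => [/(congr1 val)|/(congr1 val)|/eqP + /eqP +];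
  case: tpermP => [/(congr1 val)|/(congr1 val)|/eqP + /eqP +];
  rewrite -?val_eqE /=; lia.
Qed.

Lemma tperm_sigma a (i j : 'I_n) u :
  tperm i j * (sigma a * u) = sigma a * (tperm (sigma a i) (sigma a j) * u).
Proof. by rewrite -tpermJ conjgE !mulgA mulgV mul1g. Qed.

(* Following the two positions through the word, some letter swaps exactly the pair they have
   become; deleting that letter undoes the swap. *)
Lemma strong_exchange s (i j : 'I_n) : i < j -> wp s j < wp s i ->
  exists s1 b s2, s = s1 ++ b :: s2 /\ tperm i j * wp s = wp (s1 ++ s2).
Proof.
elim: s i j => [|a s IHs] i j ij; first by rewrite wp_nil !perm1; lia.
rewrite wp_cons !permM => inv.
have [/andP[/eqP iE /eqP jE]|ijN] := boolP ((i == lo a) && (j == hi a)).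
  by exists [::], a, s; rewrite iE jE sigmaK.
have [s1 [b [s2 [-> sE]]]] := IHs _ _ (sigma_lt ij (negbTE ijN)) inv.
by exists (a :: s1), b, s2; rewrite !cat_cons wp_cons -sE tperm_sigma.
Qed.

(** Exchange for the pair [lo a], [hi a] deletes a letter of a shortest word, so the length drops;
    one generator changes it by at most one. *)
Lemma len_desc u a : ~~ ascent u a -> len u = (len (sigma a * u)).+1.
Proof.
rewrite ascentN => inv; have [s sE slen] := len_word u.
rewrite -sE in inv; have [|s1 [b [s2 [s12 uE]]]] := strong_exchange _ inv; first by rewrite /=.
have := len_le (s1 ++ s2); rewrite -uE sE -sigmaE => le1.
have := len_mul (sigma a) (sigma a * u); rewrite sigmaK.
have := len_le [:: a]; rewrite wp1 /=.
by move: le1 slen; rewrite s12 !size_cat /=; move: (len (sigma a * u)); lia.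
Qed.

Lemma len_asc u a : ascent u a -> len (sigma a * u) = (len u).+1.
Proof. by move=> asc; rewrite (@len_desc _ a) ?sigmaK // ascent_sigma asc. Qed.

Lemma reduced_cons a s : reduced (a :: s) = reduced s && ascent (wp s) a.
Proof.
apply/idP/andP => [red_as|[/eqP red_s asc]]; last first.
  by rewrite /reduced wp_cons len_asc //= red_s.
have red_s := reduced_behead red_as; split=> //; apply/negPn/negP => /len_desc.
by move: red_as red_s; rewrite /reduced wp_cons /= => /eqP <- /eqP <-; lia.
Qed.

Lemma desc_word u a : ~~ ascent u a -> exists2 s, wp (a :: s) = u & reduced (a :: s).
Proof.
move=> desc; have [s sE red_s] := reduced_word (sigma a * u).
exists s; first by rewrite wp_cons sE sigmaK.
by rewrite reduced_cons red_s sE ascent_sigma.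
Qed.

Lemma exists_descent u : 0 < len u -> exists a, ~~ ascent u a.
Proof.
have [s <- slen] := len_word u; case: s slen => [<-//|a s] slen _.
exists a; rewrite wp_cons ascent_sigma negbK.
by have : reduced (a :: s) by [apply/eqP]; rewrite reduced_cons => /andP[].
Qed.

(** * Bruhat order *)

(** One multiplication by a transposition that creates an inversion. With the closure [ble] as the
    order, transitivity is immediate; [bruhatE] identifies it with the subword order. *)
Definition refl_step u v :=
  [exists i : 'I_n, exists j : 'I_n, [&& i < j, u i < u j & v == tperm i j * u]].

Definition ble u v := connect refl_step u v.

Lemma ble_refl u : ble u u.
Proof. exact: connect0. Qed.

Lemma ble_trans v u w : ble u v -> ble v w -> ble u w.
Proof. exact: connect_trans. Qed.

Lemma ble_sigma u a : ascent u a -> ble u (sigma a * u).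
Proof.
move=> asc; apply: connect1; apply/existsP; exists (lo a); apply/existsP; exists (hi a).
by apply/and3P; split=> //=.
Qed.

(** Going down the chain from [v] to [u], each step deletes one letter by [strong_exchange]. *)
Lemma ble_subword u v s : ble u v -> wp s = v -> exists2 t, subseq t s & wp t = u.
Proof.
move=> /connectP[p]; elim/last_ind: p v s => [|p v' IHp] v s /=.
  by move=> _ -> <-; exists s.
rewrite rcons_path last_rcons => /andP[pth]; set z := last u p => /existsP[i /existsP[j]].
move=> /and3P[ij zij /eqP v'E] -> sE.
have inv : wp s j < wp s i by rewrite sE v'E !permM tpermL tpermR.
have [s1 [b [s2 [s12 E]]]] := strong_exchange ij inv.
have [|t tsub tE] := IHp z (s1 ++ s2) pth erefl; first by rewrite -E sE v'E mulgA tperm2 mul1g.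
exists t => //; apply: subseq_trans tsub _; rewrite s12 subseq_cat2l; exact: subseq_cons.
Qed.

(** Conjugating by [sigma a] carries the chain from [u] to [v] over to the products. The exception
    is a step by [sigma a] itself: there [sigma a * u] is already on the chain, and the ascent at
    the top completes it. *)
Lemma ble_mul_ascent u v a : ble u v -> ascent v a -> ble (sigma a * u) (sigma a * v).
Proof.
move=> /connectP[p pth ->] {v}; elim: p u pth => [|v p IHp] u /=; first by rewrite ble_refl.
move=> /andP[/existsP[i /existsP[j /and3P[ij uij /eqP vE]]] pth] asc.
have [/andP[/eqP iE /eqP jE]|ijN] := boolP ((i == lo a) && (j == hi a)).
  have -> : sigma a * u = v by rewrite vE iE jE.
  apply: ble_trans (ble_sigma asc); apply/connectP; by exists p.
apply: ble_trans (IHp v pth asc); apply: connect1.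
apply/existsP; exists (sigma a i); apply/existsP; exists (sigma a j); apply/and3P; split.
- exact: sigma_lt (negbTE ijN).
- by rewrite !permM sigmaE !tpermK.
- by rewrite tperm_sigma sigmaE !tpermK -vE.
Qed.

Lemma subword_ble s t : reduced s -> subseq t s -> ble (wp t) (wp s).
Proof.
elim: s t => [|a s IHs] t; first by rewrite subseq0 => _ /eqP->; apply: ble_refl.
rewrite reduced_cons => /andP[red_s asc].
case: t => [|b t] /=; last case: eqP => [->|_] sub.
- move=> _; apply: ble_trans (IHs [::] red_s (sub0seq _)) _; rewrite wp_cons; exact: ble_sigma.
- by rewrite !wp_cons; apply: ble_mul_ascent => //; apply: IHs.
- by apply: ble_trans (IHs _ red_s sub) _; rewrite [X in ble _ X]wp_cons; apply: ble_sigma.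
Qed.

(** Letters are added from the right; when a new letter is a descent, exchange deletes another
    letter in its place. *)
Lemma reduced_subword t : exists s, [/\ subseq s t, wp s = wp t & reduced s].
Proof.
elim: t => [|a t [s [sub sE red_s]]]; first by exists [::]; split=> //; rewrite /reduced eqn_leq len_le.
have [asc|desc] := boolP (ascent (wp s) a).
  by exists (a :: s); rewrite /= eqxx sub !wp_cons sE reduced_cons red_s asc.
have := desc; rewrite ascentN => inv.
have [|s1 [b [s2 [s12 E]]]] := strong_exchange _ inv; first by rewrite /=.
exists (s1 ++ s2); split.
- apply: subseq_trans (subseq_cons t a); apply: subseq_trans sub.
  by rewrite s12 subseq_cat2l subseq_cons.
- by rewrite -E wp_cons -sE sigmaE.
- have := len_desc desc; move: red_s; rewrite /reduced => /eqP <-.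
  by rewrite sigmaE E s12 !size_cat /= addnS => -[->].
Qed.

Lemma ble_reduced_subword u v s : ble u v -> wp s = v ->
  exists t, [/\ subseq t s, wp t = u & reduced t].
Proof.
move=> uv sE; have [t tsub tE] := ble_subword uv sE.
have [t' [sub t'E red]] := reduced_subword t.
by exists t'; rewrite t'E tE red; split=> //; apply: subseq_trans tsub.
Qed.

Lemma bruhatE u v : bruhat u v <-> ble u v.
Proof.
split=> [[s [t [/reduced_decompositionE[<- red_s] /reduced_decompositionE[<- red_t]]]]|uv].
  exact: subword_ble.
have [t tE red_t] := reduced_word v; have [s [sub sE red_s]] := ble_reduced_subword uv tE.
by exists s, t; split=> //; apply/reduced_decompositionE.
Qed.

Lemma ble_leq_len u v : ble u v -> len u <= len v.
Proof.
have [t tE tlen] := len_word v => uv; have [s sub <-] := ble_subword uv tE.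
by rewrite -tlen (leq_trans (len_le s)) // size_subseq.
Qed.

Lemma ble_len_eq u v : ble u v -> len v <= len u -> u = v.
Proof.
have [t tE tlen] := len_word v => uv; have [s sub sE] := ble_subword uv tE.
rewrite -sE -tE => le; congr wp; apply/eqP; rewrite -(size_subseq_leqif sub) eqn_leq size_subseq //=.
by rewrite tlen -tE (leq_trans le) // len_le.
Qed.

Lemma ble_anti u v : ble u v -> ble v u -> u = v.
Proof. by move=> uv vu; apply: ble_len_eq (ble_leq_len vu). Qed.

Lemma ble_len_lt u v : ble u v -> u != v -> len u < len v.
Proof. by move=> uv; apply: contraR; rewrite -leqNgt => /(ble_len_eq uv) ->. Qed.

(** Some reduced word of [v] starts with [a]. A reduced subword for [u] cannot start with [a], so it
    lies in the remaining letters. *)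
Lemma lifting u v a : ble u v -> ascent u a -> ~~ ascent v a ->
  ble u (sigma a * v) /\ ble (sigma a * u) v.
Proof.
move=> uv asc desc; have [s sE red_as] := desc_word desc.
have [[|b t] [/= sub tE red_t]] := ble_reduced_subword uv sE.
  have ues : ble u (sigma a * v).
    by rewrite -tE -sE wp_cons sigmaK; apply: subword_ble (reduced_behead red_as) (sub0seq _).
  by split=> //; rewrite -[v](sigmaK a); apply: ble_mul_ascent; rewrite // ascent_sigma.
have ues : ble u (sigma a * v).
  rewrite -tE -sE (wp_cons a) sigmaK; apply: subword_ble (reduced_behead red_as) _.
  case: eqP sub => // ba _; move: asc red_t.
  by rewrite -tE ba wp_cons ascent_sigma reduced_cons => /negP + /andP[].
by split=> //; rewrite -[v](sigmaK a); apply: ble_mul_ascent; rewrite // ascent_sigma.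
Qed.

Lemma ble_mul_descent u v a : ble u v -> ~~ ascent u a -> ~~ ascent v a ->
  ble (sigma a * u) (sigma a * v).
Proof.
move=> uv descu descv; have [s sE red_as] := desc_word descv.
have au : ble (sigma a * u) u.
  by rewrite -[X in ble _ X](sigmaK a); apply: ble_sigma; rewrite ascent_sigma.
have av : sigma a * v = wp s by rewrite -sE wp_cons sigmaK.
have [t [sub tE red_t]] := ble_reduced_subword uv sE.
rewrite av; case: t sub tE red_t => [|b t] sub tE red_t.
  apply: ble_trans au _; rewrite -tE; exact: subword_ble (reduced_behead red_as) (sub0seq _).
move: sub => /=; case: eqP => [ba|_] sub.
  by rewrite -tE ba wp_cons sigmaK; apply: subword_ble (reduced_behead red_as) _.
by apply: ble_trans au _; rewrite -tE; apply: subword_ble (reduced_behead red_as) _.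
Qed.

(** Induction on the length of [v]: a left descent [a] is stripped from [v], and also from [u] when
    [u] is not below [sigma a * v]. *)
Lemma graded u v : ble u v -> u != v -> exists c, [/\ ble u c, ble c v & len c = (len u).+1].
Proof.
have [m] := ubnP (len v); elim: m => // m IHm in u v * => ltm uv neq.
have [a desc] : exists a, ~~ ascent v a.
  by apply: exists_descent; apply: leq_ltn_trans (ble_len_lt uv neq).
have av : ble (sigma a * v) v.
  by rewrite -[X in ble _ X](sigmaK a); apply: ble_sigma; rewrite ascent_sigma.
have ltav := len_desc desc.
have [uav|uNav] := boolP (ble u (sigma a * v)).
  have [->|neq'] := eqVneq u (sigma a * v); first by exists v; rewrite av ble_refl.
  have [|c [uc cav lenc]] := IHm u _ _ uav neq'; first by lia.
  by exists c; split=> //; apply: ble_trans av.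
have descu : ~~ ascent u a by apply: contra uNav => asc; case: (lifting uv asc desc).
have auav := ble_mul_descent uv descu desc.
have neq' : sigma a * u != sigma a * v by apply: contraNneq neq => /mulgI->.
have [|c [uc cav lenc]] := IHm _ _ _ auav neq'; first by lia.
have ascv : ascent (sigma a * v) a by rewrite ascent_sigma.
have [asc|descc] := boolP (ascent c a).
  exists (sigma a * c); split.
  - by rewrite -[u](sigmaK a); apply: ble_mul_ascent.
  - by rewrite -[v](sigmaK a); apply: ble_mul_ascent.
  - by rewrite len_asc // lenc (len_desc descu).
have asc' : ascent (sigma a * u) a by rewrite ascent_sigma.
(* Lifting gives [u] below [c], hence [u = c] by length, so that [u] would lie below [sigma a * v]
   after all. *)
have [_] := lifting uc asc' descc; rewrite sigmaK => /ble_len_eq.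
by rewrite lenc (len_desc descu) => uE; rewrite uE ?cav in uNav.
Qed.

(** Let [a] be a descent of [v]. If it is an ascent of [u], the middles are [sigma a * v] and
    [sigma a * u]. Otherwise [a] is stripped from both ends and the middles found by induction are
    multiplied back. *)
Lemma two_middles u v : ble u v -> len v = (len u).+2 -> exists c d,
  [/\ c != d, ble u c, ble c v, ble u d & ble d v] /\ len c = (len u).+1 /\ len d = (len u).+1.
Proof.
have [m] := ubnP (len v); elim: m => // m IHm in u v * => ltm uv lenv.
have [a desc] : exists a, ~~ ascent v a by apply: exists_descent; rewrite lenv.
have ascv : ascent (sigma a * v) a by rewrite ascent_sigma.
have av : ble (sigma a * v) v by rewrite -[X in ble _ X](sigmaK a); apply: ble_sigma.
have ltav := len_desc desc.
have [asc|descu] := boolP (ascent u a).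
  have [uav auv] := lifting uv asc desc.
  exists (sigma a * v), (sigma a * u); split; last by split; [apply: succn_inj; rewrite -ltav | exact: len_asc].
  split=> //; last exact: ble_sigma.
  by apply/eqP => /mulgI E; move: lenv; rewrite E; lia.
have ltau := len_desc descu.
have ascu : ascent (sigma a * u) a by rewrite ascent_sigma.
have auav := ble_mul_descent uv descu desc.
have [||c [d [[neq auc cav aud dav] [lenc lend]]]] := IHm _ _ _ auav; try by lia.
have up e : ascent e a -> ble (sigma a * u) e -> ble e (sigma a * v) ->
    ble u (sigma a * e) /\ ble (sigma a * e) v.
  by move=> asce ae ea; split; [rewrite -[u](sigmaK a) | rewrite -[v](sigmaK a)];
    apply: ble_mul_ascent.
(* A middle that cannot be multiplied back is [u] itself; then [u] lies below [sigma a * v], which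
   serves as the missing middle in [other]. *)
have down e : ~~ ascent e a -> ble (sigma a * u) e -> len e = (len (sigma a * u)).+1 -> e = u.
  move=> desce ae lene; have [_] := lifting ae ascu desce; rewrite sigmaK => /ble_len_eq ->//.
  by rewrite lene ltau.
have other e : ascent e a -> ble (sigma a * u) e -> ble e (sigma a * v) ->
    len e = (len (sigma a * u)).+1 -> ble u (sigma a * v) -> exists c d,
  [/\ c != d, ble u c, ble c v, ble u d & ble d v] /\ len c = (len u).+1 /\ len d = (len u).+1.
  move=> asce ae ea lene uav; have [] := up e asce ae ea.
  exists (sigma a * v), (sigma a * e); split; last first.
    by split; [apply: succn_inj; rewrite -ltav | rewrite len_asc // lene -ltau].
  split=> //; apply/eqP => /mulgI E; move: desc; rewrite E asce. by [].
have [ascc|descc] := boolP (ascent c a); have [ascd|descd] := boolP (ascent d a).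
- have [] := up c ascc auc cav; have [] := up d ascd aud dav.
  exists (sigma a * c), (sigma a * d); split; last by rewrite !len_asc // lenc lend -ltau.
  by split=> //; apply: contraNneq neq => /mulgI->.
- by apply: other ascc _ _ _ _ => //; rewrite -(down d).
- by apply: other ascd _ _ _ _ => //; rewrite -(down c).
- by move: neq; rewrite (down c) // (down d) // eqxx.
Qed.

End Bruhat.

(** * Words with a single letter [k] *)

Section LettersAndAtoms.

Variable n : nat.
Implicit Types (a b k : 'I_n.-1) (u v w : 'S_n) (s t x y : seq 'I_n.-1)
  (p : bool * 'I_n.-1).

Local Notation wp := (@word_prod n).

Lemma val_sigma a (p : 'I_n) :
  sigma a p = (if p == a :> nat then a.+1 else if p == a.+1 :> nat then a : nat else p) :> nat.
Proof.
by rewrite sigmaE; case: tpermP => [->|->|/eqP + /eqP +] /=;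
  rewrite -?val_eqE /=; do ?case: eqP => //; lia.
Qed.

Lemma sigma_inj : injective (@sigma n).
Proof.
move=> a b /(congr1 (fun u : 'S_n => u (lo a) : nat)); rewrite !val_sigma /= eqxx => E.
by apply: val_inj; move: E; do 2?case: eqP => //=; lia.
Qed.

Definition adjacent a b := (a.+1 == b :> nat) || (a == b.+1 :> nat).

Lemma adjacent_neq a b : adjacent a b -> a != b.
Proof. by apply: contraTneq => ->; rewrite /adjacent; lia. Qed.

Lemma sigma_commute a b : a != b -> (sigma a * sigma b == sigma b * sigma a) = ~~ adjacent a b.
Proof.
move=> ab; apply/eqP/idP => [E|nadj]; last first.
  rewrite conjgC {2}sigmaE tpermJ; congr (_ * _).
  by rewrite !sigma_fix // -?val_eqE /=; move: nadj ab; rewrite /adjacent -val_eqE /=; lia.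
apply/negP => /orP[/eqP adj|/eqP adj].
  have /(congr1 val) := congr1 (fun u : 'S_n => u (lo a)) E.
  by rewrite /= !permM !val_sigma /= -adj; do !case: eqP => //=; lia.
have /(congr1 val) := congr1 (fun u : 'S_n => u (hi a)) E.
by rewrite /= !permM !val_sigma /= adj; do !case: eqP => //=; lia.
Qed.

(** Only the letter [a] moves a position across the cut between [a] and [a.+1]. *)
Lemma wp_le_stable s a (p : 'I_n) : a \notin s -> (wp s p <= a) = (p <= a).
Proof.
elim: s p => [|b s IHs] p; first by rewrite wp_nil perm1.
rewrite inE negb_or -val_eqE /= => /andP[ab sa].
rewrite wp_cons permM IHs // val_sigma; do 2?case: eqP => //=; lia.
Qed.

Lemma ascent_notin s a : a \notin s -> ascent (wp s) a.
Proof.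
move=> sa; have := wp_le_stable (lo a) sa; have := wp_le_stable (hi a) sa.
by rewrite /ascent /= leqnn ltnn; lia.
Qed.

Lemma uniq_reduced s : uniq s -> reduced s.
Proof.
elim: s => [|a s IHs] /=; first by rewrite /reduced eqn_leq len_le.
by case/andP=> sa /IHs red_s; rewrite reduced_cons red_s ascent_notin.
Qed.

Lemma len_sigma a : len (sigma a) = 1%N.
Proof. by have /eqP := @uniq_reduced [:: a] isT; rewrite wp1. Qed.

Lemma mem_reduced s a : reduced s -> (a \in s) = ble (sigma a) (wp s).
Proof.
move=> red_s; apply/idP/idP => [sa|le_as].
  by rewrite -wp1; apply: subword_ble; rewrite ?sub1seq.
have [t [sub tE /eqP red_t]] := ble_reduced_subword le_as erefl.
rewrite tE len_sigma in red_t; case: t red_t tE sub => [|b [|//]] // _.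
by rewrite wp1 sub1seq => /sigma_inj->.
Qed.

Lemma eq_mem_reduced s t : reduced s -> reduced t -> wp s = wp t -> s =i t.
Proof. by move=> red_s red_t E a; rewrite !mem_reduced // E. Qed.

Lemma reduced_wp_eq s t : reduced s -> wp s = wp t -> size s = size t -> reduced t.
Proof. by rewrite /reduced => /eqP red_s <- <-; apply/eqP. Qed.

(** Reduced words of one element have the same letters. This is what separates atoms [ak] from atoms
    [kb]. *)
Lemma sigma_swap_eq a b k : a != k -> sigma a * sigma k = sigma k * sigma b ->
  a = b /\ ~~ adjacent a k.
Proof.
move=> ak E; have E' : wp [:: a; k] = wp [:: k; b] by rewrite !wp_cons wp_nil !mulg1.
have red1 : reduced [:: a; k] by apply: uniq_reduced; rewrite /= inE ak.
have red2 := reduced_wp_eq red1 E' erefl.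
have := eq_mem_reduced red1 red2 E' a; rewrite !inE eqxx (negbTE ak) /= => /esym/eqP ab.
by split=> //; rewrite -sigma_commute // {2}ab E.
Qed.

Lemma subseq_splitr k t x y : k \notin x -> k \notin y -> k \in t -> subseq t (x ++ k :: y) ->
  exists x' y', [/\ t = x' ++ k :: y', subseq x' x & subseq y' y].
Proof.
elim: x t => [|a x IHx] [|b t] //= kx ky kt.
  case: eqP => [->|_] sub; first by exists [::], t.
  by case/negP: ky; apply: mem_subseq sub _ kt.
move: kx; rewrite inE negb_or => /andP[ka kx].
case: eqP => [ba|_] sub.
  move: kt; rewrite inE ba (negbTE ka) /= => kt.
  have [x' [y' [-> sx sy]]] := IHx _ kx ky kt sub.
  by exists (a :: x'), y'; rewrite /= eqxx.
have [x' [y' [-> sx sy]]] := IHx _ kx ky kt sub.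
by exists x', y'; split=> //; apply: subseq_trans sx (subseq_cons _ _).
Qed.

Lemma interval_subword k u x y : k \notin x -> k \notin y ->
  ble (sigma k) u -> ble u (wp (x ++ k :: y)) ->
  exists x' y', [/\ reduced (x' ++ k :: y'), wp (x' ++ k :: y') = u, subseq x' x & subseq y' y].
Proof.
move=> kx ky ku uw; have [t [sub tE red_t]] := ble_reduced_subword uw erefl.
have kt : k \in t by rewrite mem_reduced // tE.
have [x' [y' [tE' sx sy]]] := subseq_splitr kx ky kt sub.
by exists x', y'; rewrite -tE'.
Qed.

Definition atoms k u := [set q : 'S_n | [&& len q == 2, ble (sigma k) q & ble q u]].

Lemma atom_cases k x y q : k \notin x -> k \notin y -> q \in atoms k (wp (x ++ k :: y)) ->
  (exists2 a, a \in x & q = sigma a * sigma k) \/ (exists2 a, a \in y & q = sigma k * sigma a).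
Proof.
move=> kx ky; rewrite inE => /and3P[/eqP lenq kq qw].
have [x' [y' [/eqP + tE sx sy]]] := interval_subword kx ky kq qw.
rewrite tE lenq -{}tE.
case: x' sx => [|a [|? ?]] sx; case: y' sy => [|b [|? ?]] sy //=;
  rewrite ?size_cat ?addnS //= => _.
- right; exists b; first by rewrite -sub1seq.
  by rewrite !wp_cons wp_nil mulg1.
- left; exists a; first by rewrite -sub1seq.
  by rewrite !wp_cons wp_nil mulg1.
Qed.

(** The flag [true] puts the letter to the left of [k], so a letter present on both sides has two
    indices. *)
Definition side_word k (p : bool * 'I_n.-1) := if p.1 then [:: p.2; k] else [:: k; p.2].

Definition side_atom k p : 'S_n := wp (side_word k p).

Lemma side_atom_left k a : side_atom k (true, a) = sigma a * sigma k.
Proof. by rewrite /side_atom !wp_cons wp_nil mulg1. Qed.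

Lemma side_atom_right k a : side_atom k (false, a) = sigma k * sigma a.
Proof. by rewrite /side_atom !wp_cons wp_nil mulg1. Qed.

Lemma reduced_side_word k p : p.2 != k -> reduced (side_word k p).
Proof. by case: p => [] [] a ak; apply: uniq_reduced; rewrite /= inE ?ak // eq_sym ak. Qed.

Lemma len_side_atom k p : p.2 != k -> len (side_atom k p) = 2.
Proof. by move=> /reduced_side_word/eqP <-; case: p => [] []. Qed.

Lemma ble_side_atom k p : p.2 != k -> ble (sigma k) (side_atom k p).
Proof.
move=> /reduced_side_word red_p; rewrite -mem_reduced //.
by case: p {red_p} => [] [] a; rewrite !inE eqxx ?orbT.
Qed.

Definition special k x y : Prop :=
  [/\ uniq x /\ uniq y, forall a, a \in x -> a \in y -> adjacent a k
    & k \notin x /\ k \notin y].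

Lemma special_subseq k x y x' y' : subseq x' x -> subseq y' y -> special k x y -> special k x' y'.
Proof.
move=> sx sy [[ux uy] adj [kx ky]]; split.
- by split; [apply: subseq_uniq ux | apply: subseq_uniq uy].
- by move=> a /(mem_subseq sx) ax /(mem_subseq sy); apply: adj.
- by split; [apply: contra kx | apply: contra ky]; apply: mem_subseq.
Qed.

(** Induction on [x]. A first letter [a] that is new is an ascent at once; the case with content is
    an [a] that recurs in [y] and is therefore a neighbour of [k]. *)
Lemma special_reduced k x y : special k x y -> reduced (x ++ k :: y).
Proof.
elim: x => [|a x IHx] [[ux uy] adj [kx ky]].
  by rewrite /= reduced_cons uniq_reduced // ascent_notin.
rewrite /= reduced_cons IHx /=; last first.
  by apply: special_subseq (subseq_cons x a) (subseq_refl y) _.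
move: ux kx; rewrite /= inE negb_or => /andP[ax ux] /andP[ka kx].
have [ay|ay] := boolP (a \in y); last first.
  by apply: ascent_notin; rewrite mem_cat inE !negb_or ax eq_sym ka.
have := adj a (mem_head _ _) ay; rewrite /adjacent => adj_ak.
have := wp_le_stable (lo a) ax; have := wp_le_stable (lo a) kx.
have := wp_le_stable (hi a) ax; have := wp_le_stable (hi a) kx.
rewrite /= leqnn ltnn => hik hia lok loa.
(* As [x] preserves the cuts at [a] and at [k], it fixes whichever of [lo a], [hi a] lies between
   them. After [sigma k] the two images are on opposite sides of the cut at [k], which [y]
   preserves. *)
have lo_le : sigma k (wp x (lo a)) <= k by rewrite val_sigma; do 2?case: ifP; lia.
have hi_gt : (sigma k (wp x (hi a)) <= k) = false by rewrite val_sigma; do 2?case: ifP; lia.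
rewrite /ascent wp_cat wp_cons !permM.
by apply: (@leq_ltn_trans k); rewrite ?ltnNge wp_le_stable // hi_gt.
Qed.

(** An atom below the word comes from a letter of [x] or of [y]; the adjacency hypotheses exclude
    the wrong side, by [sigma_swap_eq]. *)
Lemma ble_side_atomE k x y p : special k x y -> p.2 != k ->
    (p.1 -> p.2 \in y -> adjacent p.2 k) -> (~~ p.1 -> p.2 \in x -> adjacent p.2 k) ->
  ble (side_atom k p) (wp (x ++ k :: y)) = (p.2 \in if p.1 then x else y).
Proof.
move=> sp pk ady adx; have red := special_reduced sp; have [_ _ [kx ky]] := sp.
apply/idP/idP => [le|p_in].
  have p_atom : side_atom k p \in atoms k (wp (x ++ k :: y)).
    by rewrite inE len_side_atom // ble_side_atom.
  case: (atom_cases kx ky p_atom) => [] [a].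
  - move=> ax; case: p pk ady adx {le p_atom} => [[] b] /= bk _ adx.
    + by rewrite side_atom_left => /mulIg/sigma_inj->.
    + rewrite side_atom_right => /esym E; have ak : a != k by apply: contraNneq kx => <-.
      by have [ab] := sigma_swap_eq ak E; rewrite ab adx // -ab.
  - move=> ay; case: p pk ady adx {le p_atom} => [[] b] /= bk ady _.
    + by rewrite side_atom_left => E; have [ab] := sigma_swap_eq bk E; rewrite ady // ab.
    + by rewrite side_atom_right => /mulgI/sigma_inj->.
apply: subword_ble => //; rewrite /side_word; case: p.1 p_in => p_in.
  by rewrite -cat1s; apply: cat_subseq; rewrite sub1seq ?mem_head.
by rewrite -[X in subseq X]cat0s; apply: cat_subseq; rewrite ?sub0seq //= eqxx sub1seq.
Qed.

(** Both subwords of a duplicate-free word are filters of it, so they are determined by their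
    letters. *)
Lemma sub_subseq_uniq (T : eqType) (r r1 r2 : seq T) : uniq r -> subseq r1 r -> subseq r2 r ->
  {subset r1 <= r2} -> subseq r1 r2.
Proof.
move=> ur /(subseq_uniqP ur) E1 /(subseq_uniqP ur) E2 sub; rewrite E1 E2.
have -> : [seq z <- r | z \in r1] = [seq z <- [seq z <- r | z \in r2] | z \in r1].
  by rewrite -filter_predI; apply: eq_filter => z /=; case r1z: (z \in r1); rewrite ?(sub _ r1z).
exact: filter_subseq.
Qed.

End LettersAndAtoms.

(** * Words satisfying (1)-(3) give boolean intervals *)

Section SpecialBoolean.

Variables (n : nat) (k : 'I_n.-1) (x y : seq 'I_n.-1).
Hypothesis xy_special : special k x y.

Local Notation wp := (@word_prod n).
Local Notation w := (wp (x ++ k :: y)).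

Definition side_pred (p : bool * 'I_n.-1) := p.2 \in if p.1 then x else y.

Definition side_atoms_below (u : 'S_n) : {set {p | side_pred p}} :=
  [set p | ble (side_atom k (val p)) u].

Lemma side_neq p : side_pred p -> p.2 != k.
Proof.
have [_ _ [kx ky]] := xy_special.
by apply: contraTneq; rewrite /side_pred => ->; case: p.1.
Qed.

Lemma mem_side_atoms_below (p : {p | side_pred p}) x' y' : subseq x' x -> subseq y' y ->
  (p \in side_atoms_below (wp (x' ++ k :: y'))) = ((val p).2 \in if (val p).1 then x' else y').
Proof.
move=> sx sy; have [_ adj _] := xy_special; have pk := side_neq (valP p).
rewrite inE; apply: ble_side_atomE (special_subseq sx sy xy_special) pk _ _.
  by move=> px /(mem_subseq sy); apply: adj; have := valP p; rewrite /side_pred px.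
by move=> /negbTE py /(mem_subseq sx) /adj; apply; have := valP p; rewrite /side_pred py.
Qed.

Lemma side_atoms_below_mono u v : ble (sigma k) u -> ble u w -> ble (sigma k) v -> ble v w ->
  ble u v <-> side_atoms_below u \subset side_atoms_below v.
Proof.
have [[ux uy] _ [kx ky]] := xy_special => ku uw kv vw; split=> [uv|].
  by apply/subsetP => p; rewrite !inE => /ble_trans; apply.
have [x1 [y1 [_ <- sx1 sy1]]] := interval_subword kx ky ku uw.
have [x2 [y2 [red2 <- sx2 sy2]]] := interval_subword kx ky kv vw.
(* Atoms record the letters on each side, so inclusion of atom sets makes [x1], [y1] subwords of
   [x2], [y2]. *)
have side (p : {p | side_pred p}) := mem_side_atoms_below p.
move=> /subsetP sub; apply: subword_ble => //; apply: cat_subseq; last rewrite /= eqxx.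
  apply: (sub_subseq_uniq ux sx1 sx2) => a ax1.
  have pa : side_pred (true, a) by rewrite /side_pred /= (mem_subseq sx1).
  by have := sub (exist side_pred _ pa); rewrite !side //=; apply.
apply: (sub_subseq_uniq uy sy1 sy2) => a ay1.
have pa : side_pred (false, a) by rewrite /side_pred /= (mem_subseq sy1).
by have := sub (exist side_pred _ pa); rewrite !side //=; apply.
Qed.

Lemma side_atoms_below_surj (A : {set {p | side_pred p}}) :
  exists u, [/\ ble (sigma k) u, ble u w & side_atoms_below u = A].
Proof.
pose side b a := (b, a) \in [set val p | p in A].
have sx := filter_subseq (side true) x; have sy := filter_subseq (side false) y.
have red := special_reduced (special_subseq sx sy xy_special).
exists (wp (filter (side true) x ++ k :: filter (side false) y)); split.
- by rewrite -mem_reduced // mem_cat mem_head orbT.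
- by apply: subword_ble (special_reduced xy_special) _; rewrite cat_subseq //= eqxx.
- apply/setP => p; rewrite mem_side_atoms_below //.
  have sideE : side (val p).1 (val p).2 = (p \in A).
    by rewrite /side -surjective_pairing mem_imset //; apply: val_inj.
  by move: (valP p) sideE; rewrite /side_pred; case: (val p).1 => p_in; rewrite mem_filter p_in andbT.
Qed.

Lemma special_boolean : is_boolean (bruhat_interval (sigma k) w) (@bruhat n).
Proof.
exists {p | side_pred p}, side_atoms_below; split=> [A|u v [/bruhatE ku /bruhatE uw] [/bruhatE kv /bruhatE vw]].
  have [u [ku uw uA]] := side_atoms_below_surj A.
  exists u; split=> [|v [[/bruhatE kv /bruhatE vw] vA]]; first by split=> //; split; apply/bruhatE.
  by apply: ble_anti; apply/side_atoms_below_mono; rewrite // uA vA.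
by rewrite bruhatE; apply: side_atoms_below_mono.
Qed.

End SpecialBoolean.

(** * Boolean implies distributive implies modular *)

Section BooleanDistributive.

Import Order.DefaultSetSubsetOrder.

Lemma boolean_distributive (T : Type) (D : T -> Prop) (leT : T -> T -> Prop) :
  is_boolean D leT -> is_distributive_lattice D leT.
Proof. by case=> X iso; exists _, ({set X} : distrLatticeType _). Qed.

End BooleanDistributive.

Lemma distributive_modular (T : Type) (D : T -> Prop) (leT : T -> T -> Prop) :
  is_distributive_lattice D leT -> is_modular_lattice D leT.
Proof.
case=> disp [L iso]; exists disp, L; split=> // a b c ab.
by rewrite joinIr (join_r ab).
Qed.

(** * From the counting and crown conditions to a word satisfying (1)-(3) *)

Section SlimWords.

Variables (n : nat) (k : 'I_n.-1).
Implicit Types (a b : 'I_n.-1) (u v w : 'S_n) (s x y : seq 'I_n.-1).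

Local Notation wp := (@word_prod n).

(** Both sides are conjugates of a transposition and swap the outer two of three consecutive
    positions. *)
Lemma sigma_braid a b : adjacent a b ->
  sigma a * sigma b * sigma a = sigma b * sigma a * sigma b.
Proof.
have conjE c d : sigma c * sigma d * sigma c = tperm (sigma c (lo d)) (sigma c (hi d)).
  by rewrite -tpermJ conjgE mulgA {3}sigmaE tpermV.
rewrite !conjE => /orP[] /eqP adj.
  by congr tperm; apply: val_inj; rewrite /= !val_sigma /=; do !case: eqP => //=; lia.
by congr tperm; apply: val_inj; rewrite /= !val_sigma /=; do !case: eqP => //=; lia.
Qed.

(* These two conditions are all that is retained of modularity: unlike it, they visibly pass to
   smaller elements, which allows induction on the length. *)
Definition slim w : Prop :=
  (forall u, ble (sigma k) u -> ble u w -> len u <= #|atoms k u|.+1) /\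
  (forall a b, adjacent a k -> adjacent b k -> a != b -> ~~ ble (wp [:: k; a; b; k]) w).

Lemma slim_ble u w : ble u w -> slim w -> slim u.
Proof.
move=> uw [count crown]; split=> [v kv vu|a b ak bk ab]; first exact/count/(ble_trans vu).
by apply: contra (crown a b ak bk ab) => /ble_trans; apply.
Qed.

(* Each letter of [x] or [y] accounts for at most one atom, so counting leaves no room for a
   repetition. *)
Lemma slim_special x y : k \notin x -> k \notin y -> reduced (x ++ k :: y) ->
  slim (wp (x ++ k :: y)) -> special k x y.
Proof.
move=> kx ky red [count _]; set w := wp _ in count.
(* [L] lists all candidate atoms and has one entry less than the length of [w]. By [count] there are
   at least that many atoms, so the entries are distinct. *)
pose L := [seq sigma a * sigma k | a <- x] ++ [seq sigma k * sigma a | a <- y].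
have kw : ble (sigma k) w by rewrite -mem_reduced // mem_cat mem_head orbT.
have uL : uniq L.
  apply/card_uniqP/eqP; rewrite eqn_leq card_size /=.
  have sub : atoms k w \subset L.
    apply/subsetP => q /(atom_cases kx ky)[] [a a_in ->]; rewrite mem_cat; apply/orP.
      by left; apply: map_f.
    by right; apply: map_f.
  apply: leq_trans (subset_leq_card sub); have := count w kw (ble_refl w).
  by move: red; rewrite /reduced => /eqP <-; rewrite !size_cat !size_map /= addnS ltnS.
move: uL; rewrite cat_uniq => /and3P[/map_uniq ux /hasPn disj /map_uniq uy].
(* A common letter commuting with [k] would put the same atom into both halves of [L]. *)
split=> // a ax ay; have ak : a != k by apply: contraNneq kx => <-.
apply/negPn/negP; rewrite -sigma_commute // => /eqP E.
by have /negP[] := disj _ (map_f _ ay); rewrite -E; apply: map_f.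
Qed.

Definition single w : Prop :=
  exists x y, [/\ reduced (x ++ k :: y), wp (x ++ k :: y) = w, k \notin x & k \notin y].

Lemma single_cons w a s : a != k -> reduced (a :: s) -> wp (a :: s) = w -> single (wp s) -> single w.
Proof.
move=> ak red_as <- [x [y [red E kx ky]]]; exists (a :: x), y; split=> //=.
- apply: (reduced_wp_eq red_as); first by rewrite !wp_cons E.
  by move: red (reduced_behead red_as); rewrite /reduced E /= => /eqP-> /eqP->.
- by rewrite !wp_cons E.
- by rewrite inE negb_or eq_sym ak.
Qed.

Lemma single_rcons w a s : a != k -> reduced (rcons s a) -> wp (rcons s a) = w ->
  single (wp s) -> single w.
Proof.
rewrite -cats1 => ak red_sa <- [x [y [red E kx ky]]]; exists x, (y ++ [:: a]).
rewrite -cat_cons catA; split=> //.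
- apply: (reduced_wp_eq red_sa); first by rewrite !(wp_cat _ [:: a]) E.
  have [+ _] := reduced_cat red_sa; move: red; rewrite /reduced E !(size_cat _ [:: a]).
  by move=> /eqP-> /eqP->.
- by rewrite !(wp_cat _ [:: a]) E.
- by rewrite mem_cat negb_or ky inE eq_sym ak.
Qed.

Lemma slim_single w : slim w -> ble (sigma k) w -> single w.
Proof.
have [m] := ubnP (len w); elim: m => // m IHm in w *; rewrite ltnS => lew slim_w kw.
have IHsub u s : wp s = u -> ble u w -> k \in s -> reduced s -> size s < len w -> single u.
  move=> sE uw ks red_s lt; apply: IHm; last by rewrite -sE -mem_reduced.
    by rewrite -sE; move/eqP: red_s => <-; apply: leq_trans lew.
  exact: slim_ble slim_w.
have kin s : reduced s -> wp s = w -> k \in s by move=> red sE; rewrite mem_reduced // sE.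
have left a s : a != k -> reduced (a :: s) -> wp (a :: s) = w -> single w.
  move=> ak red E; apply: (single_cons ak red E); have red_s := reduced_behead red.
  apply: IHsub erefl _ _ red_s _.
  - by rewrite -E; apply: subword_ble (subseq_cons _ _).
  - by have := kin _ red E; rewrite inE eq_sym (negbTE ak).
  - by rewrite -E; move/eqP: red => <-.
have right a s : a != k -> reduced (rcons s a) -> wp (rcons s a) = w -> single w.
  move=> ak red E; apply: (single_rcons ak red E).
  have red_s : reduced s by move: red; rewrite -cats1 => /reduced_cat[].
  apply: IHsub erefl _ _ red_s _.
  - by rewrite -E; apply: subword_ble (subseq_rcons _ _).
  - by have := kin _ red E; rewrite mem_rcons inE eq_sym (negbTE ak).
  - by rewrite -E; move/eqP: red => <-; rewrite size_rcons.
have [[|a s] sE red_s] := reduced_word w; first by have := kin _ red_s sE.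
have [ak|] := eqVneq a k; last by move=> ak; apply: left ak red_s sE.
case/lastP: s sE red_s => [|z b]; rewrite {a}ak => sE red_s.
  by exists [::], [::].
have [bk|] := eqVneq b k; last by move=> bk; apply: (right b (k :: z)).
rewrite {b}bk -rcons_cons in sE red_s.
have red_kz : reduced (k :: z) by move: red_s; rewrite -cats1 => /reduced_cat[].
have kz_w : ble (wp (k :: z)) w by rewrite -sE; apply: subword_ble (subseq_rcons _ _).
(* The word is now [k z k]. Induction rewrites [k z] as [x k y], and [x k y k] is again a reduced
   word of [w]. *)
have [||x [y [red_xy xyE kx ky]]] := IHsub _ _ erefl kz_w _ red_kz; first exact: mem_head.
  by rewrite -sE; move/eqP: red_s => <-; rewrite size_rcons.
have [E1 red_xyk] : wp (x ++ k :: rcons y k) = w /\ reduced (x ++ k :: rcons y k).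
  have E1 : wp (x ++ k :: rcons y k) = w.
    by rewrite -rcons_cons -rcons_cat -cats1 wp_cat xyE -sE -[rcons _ _]cats1 wp_cat.
  split=> //; apply: (reduced_wp_eq red_s); first by rewrite E1.
  move: red_xy red_kz; rewrite /reduced xyE => /eqP sz /eqP sz'.
  by rewrite -rcons_cons -rcons_cat !size_rcons sz sz'.
have [[_ uy] _ _] : special k x y.
  by apply: slim_special red_xy _ => //; rewrite xyE; apply: slim_ble slim_w.
case: x kx red_xy xyE E1 red_xyk => [|a x]; last first.
  by rewrite inE negb_or => /andP[ka _] _ _ E red; apply: left red E; rewrite eq_sym.
move=> _ _ _ /=; case: y uy ky => [|a y1] uy ky E red.
  have := len_le [::] (n := n); move: red.
  by rewrite /reduced !wp_cons !wp_nil mulg1 sigma2 => /eqP <-.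
have ak : a != k by apply: contraNneq ky => <-; rewrite mem_head.
(* If [a] commutes with [k], it moves to the front and [left] applies. *)
have [adj_a|nadj] := boolP (adjacent a k); last first.
  have E' : wp (k :: a :: rcons y1 k) = wp (a :: k :: rcons y1 k).
    by move: nadj; rewrite -sigma_commute // => /eqP; rewrite !wp_cons !mulgA => ->.
  by apply: (left a (k :: rcons y1 k) ak); [apply: (reduced_wp_eq red E') | rewrite -E'].
move: E red uy ky; case/lastP: y1 => [|y2 b] E red uy ky.
  have E' : wp [:: k; a; k] = wp [:: a; k; a].
    by rewrite !wp_cons wp_nil !mulg1 !mulgA (sigma_braid adj_a).
  by apply: (left a [:: k; a] ak); [apply: (reduced_wp_eq red E') | rewrite -E'].
have bk : b != k by apply: contraNneq ky => <-; rewrite inE mem_rcons mem_head orbT.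
have [adj_b|nadj] := boolP (adjacent b k); last first.
  have E' : wp (k :: rcons (a :: rcons y2 b) k) = wp (rcons (rcons (k :: a :: y2) k) b).
    move: nadj; rewrite -sigma_commute // => /eqP comm.
    rewrite -!rcons_cons -!cats1 -!catA !(wp_cat _ (_ :: _)) /=.
    by rewrite !wp_cons wp_nil !mulg1 comm.
  apply: (right b (rcons (k :: a :: y2) k) bk); last by rewrite -E'.
  by apply: (reduced_wp_eq red E'); rewrite /= !size_rcons.
have ab : a != b.
  by move: uy => /= /andP[+ _]; apply: contraNneq => ->; rewrite mem_rcons mem_head.
(* The word [k a ... b k] contains the forbidden [k a b k]. *)
have [_ /(_ a b adj_a adj_b ab) /negP[]] := slim_w.
rewrite -E; apply: subword_ble => //=; rewrite !eqxx.
by rewrite -!cats1 -catA; apply: suffix_subseq.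
Qed.

End SlimWords.

(** * Modular intervals *)

Section ModularSlim.

Variables (n : nat) (k : 'I_n.-1) (w : 'S_n).
Implicit Types (a b : 'I_n.-1) (u v p q z : 'S_n).

Local Notation wp := (@word_prod n).

Lemma graded_between u v m : ble u v -> len u <= m <= len v ->
  exists z, [/\ ble u z, ble z v & len z = m].
Proof.
move=> uv /andP[um]; elim: m um => [|m IHm] um mv.
  by exists u; split; [exact: ble_refl | | apply/eqP; rewrite -leqn0].
move: um; rewrite leq_eqVlt => /orP[/eqP <-|um]; first by exists u; rewrite ble_refl.
have [z [uz zv lenz]] := IHm um (ltnW mv).
have [|z' [zz' zv' lenz']] := graded zv; first by apply: contraTneq mv => <-; rewrite lenz ltnn.
by exists z'; rewrite lenz' lenz; split=> //; apply: ble_trans zz'.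
Qed.

Definition in_interval u := ble (sigma k) u && ble u w.

(** The lattice structure is carried back to permutations, so that lengths can be used; the
    operations are total but constrained only on the interval. *)
Record modular_ops (join meet : 'S_n -> 'S_n -> 'S_n) : Prop := ModularOps {
  join_in : forall u v, in_interval u -> in_interval v -> in_interval (join u v);
  meet_in : forall u v, in_interval u -> in_interval v -> in_interval (meet u v);
  join_le : forall u v z, in_interval u -> in_interval v -> in_interval z ->
    ble (join u v) z = ble u z && ble v z;
  meet_ge : forall u v z, in_interval u -> in_interval v -> in_interval z ->
    ble z (meet u v) = ble z u && ble z v;
  modular_law : forall u v z, in_interval u -> in_interval v -> in_interval z -> ble u v ->
    join u (meet z v) = meet (join u z) v }.

Lemma in_intervalP u : reflect (bruhat_interval (sigma k) w u) (in_interval u).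
Proof.
by apply: (iffP andP) => [] [? ?]; split; apply/bruhatE.
Qed.

Lemma modular_lattice_ops :
  is_modular_lattice (bruhat_interval (sigma k) w) (@bruhat n) ->
  exists join meet, modular_ops join meet.
Proof.
case=> disp [L [modL [f [bij mono]]]].
(* [g] inverts [f]; as [f] maps the interval onto [L], the default is never taken. *)
pose g c := odflt (sigma k) [pick u | in_interval u && (f u == c)].
have gP c : in_interval (g c) /\ f (g c) = c.
  have [u [[/in_intervalP Iu fu] _]] := bij c; rewrite /g.
  case: pickP => [v /andP[Iv /eqP fv] //|/(_ u)].
  by rewrite Iu fu eqxx.
have fE u v : in_interval u -> in_interval v -> ble u v = (f u <= f v)%O.
  by move=> /in_intervalP Iu /in_intervalP Iv; apply/idP/idP => [/bruhatE/mono|/mono/bruhatE]; apply.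
have gI c := proj1 (gP c); have fg c := proj2 (gP c).
exists (fun u v => g (Order.join (f u) (f v))), (fun u v => g (Order.meet (f u) (f v))).
split=> // [u v z Iu Iv Iz|u v z Iu Iv Iz|u v z Iu Iv Iz].
- by rewrite !fE // fg leUx.
- by rewrite !fE // fg lexI.
- by rewrite fE // !fg => /modL ->.
Qed.

Hypothesis kw : ble (sigma k) w.
Variables join meet : 'S_n -> 'S_n -> 'S_n.
Hypothesis ops : modular_ops join meet.

Lemma bot_in : in_interval (sigma k).
Proof. by rewrite /in_interval ble_refl. Qed.

Lemma in_ble u : in_interval u -> ble (sigma k) u. Proof. by case/andP. Qed.

Lemma ble_in u v : ble (sigma k) u -> in_interval v -> ble u v -> in_interval u.
Proof. by move=> ku /andP[_ vw] uv; rewrite /in_interval ku (ble_trans uv). Qed.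

Lemma join_ub u v : in_interval u -> in_interval v -> ble u (join u v) /\ ble v (join u v).
Proof.
by move=> Iu Iv; apply/andP; rewrite -(join_le ops) ?ble_refl // (join_in ops).
Qed.

Lemma meet_lb u v : in_interval u -> in_interval v -> ble (meet u v) u /\ ble (meet u v) v.
Proof.
by move=> Iu Iv; apply/andP; rewrite -(meet_ge ops) ?ble_refl // (meet_in ops).
Qed.

Lemma bot_eq u : in_interval u -> len u <= 1%N -> u = sigma k.
Proof. by move=> /in_ble ku le; apply/esym/(ble_len_eq ku); rewrite len_sigma. Qed.

(** Being above two distinct elements of equal length, the join is longer than both, hence at least
    as long as [z], which bounds it. *)
Lemma join_coatoms u v z : in_interval u -> in_interval v -> in_interval z -> u != v ->
  len u = len v -> len z <= (len u).+1 -> ble u z -> ble v z -> join u v = z.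
Proof.
move=> Iu Iv Iz uv luv luz uz vz; have [uj vj] := join_ub Iu Iv.
have jz : ble (join u v) z by rewrite (join_le ops) // uz.
apply: (ble_len_eq jz); apply: leq_trans luz _; rewrite ltnNge.
apply: contra uv => le_j; have uE := ble_len_eq uj le_j; rewrite luv in le_j.
by rewrite {1}uE -(ble_len_eq vj le_j).
Qed.

(* An element of length at least three is the join of two of its coatoms, because an interval of
   length two has two middle elements. *)
Lemma ble_of_atoms u z : in_interval u -> in_interval z ->
  (forall q, q \in atoms k u -> ble q z) -> ble u z.
Proof.
have [m] := ubnP (len u); elim: m => // m IHm in u *; rewrite ltnS => lem Iu Iz uz.
have ku := in_ble Iu.
have [le1|lt1] := leqP (len u) 1; first by rewrite (bot_eq Iu le1) in_ble.
have [le2|lt2] := leqP (len u) 2.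
  by apply: uz; rewrite inE ku ble_refl eqn_leq le2 lt1.
have [v [kv vu lenv]] : exists v, [/\ ble (sigma k) v, ble v u & len v = (len u).-2].
  by apply: graded_between => //; rewrite len_sigma; lia.
have [|c [d [[cd vc cu vd du] [lenc lend]]]] := two_middles vu; first by lia.
have Ic := ble_in (ble_trans kv vc) Iu cu; have Id := ble_in (ble_trans kv vd) Iu du.
have le e : in_interval e -> ble e u -> len e = (len v).+1 -> ble e z.
  move=> Ie eu lene; apply: (IHm e _ Ie Iz).
    by rewrite lene lenv; move: lem lt2; case: (len u) => [|[|l]] //= lem _; apply: leq_trans lem.
  move=> q; rewrite !inE => /and3P[lenq kq qe]; apply: uz.
  by rewrite inE lenq kq (ble_trans qe eu).
rewrite -(join_coatoms Ic Id Iu cd _ _ cu du) ?lenc ?lend //; last first.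
  by rewrite lenv; case: (len u) lt2 => [|[|l]].
by rewrite (join_le ops) // !le.
Qed.

(** Otherwise some [z] covers [u] strictly below the join, and the modular law makes [z] the join of
    [u] and [meet q z]. This meet is the bottom or [q]: the first gives [z = u], the second puts the
    whole join below [z]. *)
Lemma len_join_atom u q : in_interval u -> in_interval q -> len q = 2 ->
  len (join u q) <= (len u).+1.
Proof.
move=> Iu Iq lenq; have [uj qj] := join_ub Iu Iq; have Ij := join_in ops Iu Iq.
rewrite leqNgt; apply/negP => lt.
have [|z [uz zj lenz]] := graded uj; first by apply: contraTneq lt => <-; rewrite -leqNgt leqnSn.
have Iz := ble_in (ble_trans (in_ble Iu) uz) Ij zj.
have := modular_law ops Iu Iz Iq uz.
have -> : meet (join u q) z = z.
  by have [_ le] := meet_lb Ij Iz; apply: ble_anti le _; rewrite (meet_ge ops) // zj ble_refl.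
have [mq mz] := meet_lb Iq Iz; have Im := meet_in ops Iq Iz.
have [le1|lt1] := leqP (len (meet q z)) 1.
  rewrite (bot_eq Im le1) => E.
  have : ble (join u (sigma k)) u by rewrite (join_le ops) ?bot_in // ble_refl in_ble.
  by rewrite E => /ble_leq_len; rewrite lenz ltnn.
move=> _; move: mz; rewrite (ble_len_eq mq) ?lenq // => qz.
have /ble_leq_len : ble (join u q) z by rewrite (join_le ops) // uz.
by rewrite lenz leqNgt lt.
Qed.

Lemma atoms_ub (qs : seq 'S_n) : {in qs, forall q, in_interval q /\ len q = 2} ->
  exists z, [/\ in_interval z, {in qs, forall q, ble q z} & len z <= (size qs).+1].
Proof.
elim: qs => [|q qs IHqs] qsP; first by exists (sigma k); rewrite bot_in len_sigma.
have [|z [Iz zub lenz]] := IHqs; first by move=> r r_in; apply: qsP; rewrite inE r_in orbT.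
have [Iq lenq] := qsP q (mem_head _ _); have [zj qj] := join_ub Iz Iq.
exists (join z q); split; first exact: (join_in ops).
  by move=> r; rewrite inE => /orP[/eqP->//|/zub rz]; apply: ble_trans zj.
by apply: leq_trans (len_join_atom Iz Iq lenq) _.
Qed.

(** Joining the atoms to the bottom one at a time costs at most one each, starting from length one;
    [u] lies below the result by [ble_of_atoms]. *)
Lemma len_le_atoms u : in_interval u -> len u <= #|atoms k u|.+1.
Proof.
move=> Iu; have [|z [Iz zub lenz]] := @atoms_ub (enum (atoms k u)).
  move=> q; rewrite mem_enum inE => /and3P[/eqP lenq kq qu]; split=> //.
  exact: ble_in qu.
rewrite cardE; apply: leq_trans lenz; apply: ble_leq_len; apply: ble_of_atoms => // q qu.
by apply: zub; rewrite mem_enum.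
Qed.

(** In either order of the two neighbours, [a b k] sends [lo k] and [hi k] to the positions [k-1]
    and [k+2], so [k] is an ascent. *)
Lemma reduced_crown a b : adjacent a k -> adjacent b k -> a != b -> reduced [:: k; a; b; k].
Proof.
move=> ak bk ab; have [ak' bk'] : a != k /\ b != k.
  by rewrite !adjacent_neq.
rewrite reduced_cons uniq_reduced /=; last by rewrite !inE negb_or ab ak' bk'.
rewrite /ascent !wp_cons wp_nil mulg1 !permM.
move: ak bk ab; rewrite /adjacent -val_eqE /= => /orP[]/eqP ak /orP[]/eqP bk ab; try lia.
  have -> : lo k = hi a by apply: val_inj.
  have -> : hi k = lo b by apply: val_inj.
  rewrite sigma_hi (sigma_fix (p := lo b)) ?sigma_lo ?(sigma_fix (p := lo a)) //=; try lia.
  by rewrite (sigma_fix (p := hi b)) /=; lia.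
have -> : lo k = hi b by apply: val_inj.
have -> : hi k = lo a by apply: val_inj.
rewrite sigma_lo (sigma_fix (p := hi b)) ?sigma_hi ?(sigma_fix (p := hi a)) //=; try lia.
by rewrite (sigma_fix (p := lo b)) /=; lia.
Qed.

(* In the 4-crown below [wp [:: k; a; b; k]] the coatoms [wp [:: a; b; k]] and [wp [:: k; a; b]]
   meet in the bottom, which contradicts the modular law for the atom [wp [:: a; k]]. *)
Lemma no_crown a b : adjacent a k -> adjacent b k -> a != b -> ~~ ble (wp [:: k; a; b; k]) w.
Proof.
move=> ak bk ab; have red := reduced_crown ak bk ab.
set z := wp _; apply/negP => zw.
have [ak' bk'] : a != k /\ b != k.
  by rewrite !adjacent_neq.
have adj c : c \in [:: a; b] -> adjacent c k /\ c != k.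
  by rewrite !inE => /orP[] /eqP->.
have kab : k \notin [:: a; b] by rewrite !inE negb_or eq_sym ak' eq_sym bk'.
have red_c : reduced [:: a; b; k] := reduced_behead red.
have red_d : reduced [:: k; a; b] by have [] := @reduced_cat _ [:: k; a; b] [:: k] red.
have red_p : reduced [:: a; k] by apply: uniq_reduced; rewrite /= inE ak'.
have mem s : reduced s -> k \in s -> subseq s [:: k; a; b; k] -> in_interval (wp s) /\ ble (wp s) z.
  move=> red_s ks sub; have sz : ble (wp s) z by apply: subword_ble.
  by split=> //; rewrite /in_interval -mem_reduced // ks (ble_trans sz).
have [Iz _] : in_interval z /\ ble z z by apply: mem; rewrite ?mem_head.
have [Ic cz] : in_interval (wp [:: a; b; k]) /\ ble (wp [:: a; b; k]) z.
  by apply: mem => //; rewrite ?inE ?eqxx ?orbT //; apply: subseq_cons.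
have [Id dz] : in_interval (wp [:: k; a; b]) /\ ble (wp [:: k; a; b]) z.
  by apply: mem => //; rewrite ?mem_head //; apply: (prefix_subseq [:: k; a; b] [:: k]).
have pc : ble (wp [:: a; k]) (wp [:: a; b; k]).
  apply: subword_ble => //; rewrite /= eqxx; case: ifP => //= _; by rewrite eqxx.
have Ip : in_interval (wp [:: a; k]).
  by apply: ble_in Ic pc; rewrite -mem_reduced // !inE eqxx orbT.
move/eqP: (red_c) (red_d) (red_p) => /= lenc /eqP /= lend /eqP /= lenp.
(* Atoms of the first element are [ck], those of the second [kd]; they coincide only if [c] commutes
   with [k], but [a] and [b] do not. *)
have no_atom q : q \in atoms k (wp [:: a; b; k]) -> q \in atoms k (wp [:: k; a; b]) -> False.
  move=> qc qd; have [[c c_in qE]|[//]] := @atom_cases _ k [:: a; b] [::] q kab isT qc.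
  have [[//]|[d d_in]] := @atom_cases _ k [::] [:: a; b] q isT kab qd.
  have [adj_c ck] := adj c c_in; rewrite qE => /(sigma_swap_eq ck)[_].
  by rewrite adj_c.
have atomE q u : in_interval q -> len q = 2 -> ble q u -> q \in atoms k u.
  by move=> Iq lenq qu; rewrite inE lenq qu in_ble.
have [md mc] := meet_lb Id Ic; have Im := meet_in ops Id Ic.
have mE : meet (wp [:: k; a; b]) (wp [:: a; b; k]) = sigma k.
  have [le1|lt1] := leqP (len (meet (wp [:: k; a; b]) (wp [:: a; b; k]))) 1; first exact: bot_eq.
  have [|q [kq qm lenq]] := @graded_between _ _ 2 (in_ble Im); first by rewrite len_sigma.
  have Iq := ble_in kq Im qm.
  by have [] := no_atom q; apply: atomE => //; apply: ble_trans qm _.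
have [pj dj] := join_ub Ip Id.
have jE : join (wp [:: a; k]) (wp [:: k; a; b]) = z.
  have jz : ble (join (wp [:: a; k]) (wp [:: k; a; b])) z.
    by rewrite (join_le ops) // dz (ble_trans pc).
  apply: (ble_len_eq jz); rewrite /z -(eqP red) /= ltnNge lend.
  apply/negP => /(ble_len_eq dj) dE.
  by apply: (no_atom (wp [:: a; k])); apply: atomE => //; rewrite dE.
(* The law now reads: [ak] joined with the bottom equals [z] met with [abk]. This puts an element of
   length three below one of length two. *)
have := modular_law ops Ip Ic Id pc; rewrite mE jE => E.
have : ble (wp [:: a; b; k]) (wp [:: a; k]).
  apply: (@ble_trans _ (meet z (wp [:: a; b; k]))); first by rewrite (meet_ge ops) // cz ble_refl.
  by rewrite -E (join_le ops) ?bot_in // ble_refl in_ble.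
by move/ble_leq_len; rewrite -lenc -lenp.
Qed.

Lemma modular_slim : slim k w.
Proof.
split=> [u ku uw|]; last exact: no_crown.
by apply: len_le_atoms; rewrite /in_interval ku.
Qed.

End ModularSlim.

Theorem theorem5p1 (n : nat) (k : 'I_n.-1) (w : 'S_n)
    (hkw : bruhat (sigma k) w) :
  let I := bruhat_interval (sigma k) w in
  (is_boolean I (@bruhat n) <->
     exists x y : seq 'I_n.-1,
       [/\ reduced_decomposition w (x ++ k :: y),
           uniq x /\ uniq y,
           (forall i : 'I_n.-1, i \in x -> i \in y ->
              i.+1 = k :> nat \/ i = k.+1 :> nat)
         & k \notin x /\ k \notin y]) /\
  (is_boolean I (@bruhat n) <-> is_modular_lattice I (@bruhat n)) /\
  (is_boolean I (@bruhat n) <-> is_distributive_lattice I (@bruhat n)).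
Proof.
move=> I; set words := exists x y, _.
have words_boolean : words -> is_boolean I (@bruhat n).
  case=> x [y [[wE _] uxy adj kxy]]; rewrite /I -wE; apply: special_boolean; split=> // a ax ay.
  by rewrite /adjacent; case: (adj a ax ay) => /eqP->; rewrite ?orbT.
have modular_words : is_modular_lattice I (@bruhat n) -> words.
  move/bruhatE in hkw; move=> /modular_lattice_ops[join [meet ops]].
  have slim_w := modular_slim hkw ops.
  have [x [y [red wE kx ky]]] := slim_single slim_w hkw.
  have [uxy adj kxy] : special k x y by apply: slim_special; rewrite ?wE.
  exists x, y; split=> //; first exact/reduced_decompositionE.
  by move=> a ax ay; case/orP: (adj a ax ay) => /eqP; [left | right].
have BD := @boolean_distributive _ I (@bruhat n).
have DM := @distributive_modular _ I (@bruhat n).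
(* The cycle is words, boolean, distributive, modular, words. *)
tauto.
Qed.
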